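(* Let $K$ be a field, let $\theta\colon C_1\to D$ and $\rho\colon C\to C_1$ be covers of curves over $K$, and assume that the monodromy group of $\psi:=\theta\circ\rho$ has a transitive Dedekind subgroup. Then, for each $\mu\in\mathrm{Aut}(\psi)$, there is a unique $\nu\in\mathrm{Aut}(\theta)$ for which $\rho\circ\mu=\nu\circ\rho$. Moreover, the map $\mu\mapsto\nu$ defines a homomorphism $\mathrm{Aut}(\psi)\to\mathrm{Aut}(\theta)$ with kernel $\mathrm{Aut}(\rho)$.
   Context: A curve over a field $K$ is a nonsingular, projective, geometrically irreducible one-dimensional variety defined over $K$. A cover of curves over $K$ is a nonconstant separable morphism, defined over $K$, between curves over $K$. The monodromy group $\mathrm{Mon}(\phi)$ of a cover $\phi\colon C\to D$ is the Galois group of the Galois closure of the function field extension $K(C)/K(D)$, viewed as a (transitive) group of permutations of the set of $\deg\phi$ embeddings of $K(C)$ into a fixed algebraic closure of $K(D)$ that restrict to the identity on $K(D)$; a subgroup is transitive if it acts transitively on this set. $\mathrm{Aut}(\phi)$ is the group (under composition) of automorphisms $\mu$ of the curve $C$ defined over $K$ with $\phi\circ\mu=\phi$. A Dedekind group is a group all of whose subgroups are normal. *)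

(* Defs.v *)
From HB Require Import structures.
From mathcomp Require Import all_boot all_order all_fingroup all_algebra all_field.
From mathcomp Require Import boolp.
From mathcomp Require Import mpoly.

Set Implicit Arguments.
Unset Strict Implicit.
Unset Printing Implicit Defensive.

Import GRing.Theory.
Local Open Scope ring_scope.

Record alg_closure (k : fieldType) := AlgClosure {
  acl :> closedFieldType;
  acl_in : {rmorphism k -> acl};
  acl_alg : forall w : acl, algebraicOver acl_in w
}.

(* A closed integral subscheme X = Proj (K[X_0..X_n] / I) of P^n_K, given by its
   function field and its generic point (x_0 : ... : x_n).  The homogeneous
   prime ideal I consists of the polynomials all of whose homogeneous components
   vanish at (x_0, ..., x_n) (see [vanishing]), and [funfield_ratio] says that
   the function field is the field of degree 0 homogeneous fractions of
   K[X_0..X_n] / I.  *)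
Record variety (K : fieldType) := Variety {
  adim : nat;
  funfield : fieldType;
  cst : {rmorphism K -> funfield};
  coord : 'I_adim.+1 -> funfield;
  coord_neq0 : exists i, coord i != 0;
  funfield_ratio : forall u : funfield,
    exists (d : nat) (f g : {mpoly K[adim.+1]}),
      [/\ f \is d.-homog, g \is d.-homog, mmap cst coord g != 0 &
          u = mmap cst coord f / mmap cst coord g]
}.

Section Variety.
Variables (K : fieldType) (X : variety K).

Local Notation poly := {mpoly K[(adim X).+1]}.
Local Notation F := (funfield X).

Definition geval (f : poly) : F := mmap (cst X) (@coord K X) f.

Definition vanishing (f : poly) : Prop :=
  forall d, geval (pihomog mdeg d f) = 0.

(* Scheme points of X: homogeneous primes of K[X_0..X_n] containing I but not
   the irrelevant ideal (X_0, ..., X_n). *)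
Record is_point (p : poly -> Prop) : Prop := IsPoint {
  point0 : p 0;
  pointD : forall f g, p f -> p g -> p (f + g);
  pointM : forall f g, p g -> p (f * g);
  point_homog : forall d f, p f -> p (pihomog mdeg d f);
  point1 : ~ p 1;
  point_prime : forall f g, p (f * g) -> p f \/ p g;
  point_on : forall f, vanishing f -> p f;
  point_relevant : exists i, ~ p 'X_i
}.

Record point := Point { pideal :> poly -> Prop; pointP : is_point pideal }.

(* The local ring of X at P, as a subring of the function field. *)
Definition regular_at (P : point) (u : F) : Prop :=
  exists (d : nat) (f g : poly),
    [/\ f \is d.-homog, g \is d.-homog, ~ P g & u = geval f / geval g].

(* Its maximal ideal. *)
Definition vanishes_at (P : point) (u : F) : Prop :=
  exists (d : nat) (f g : poly),
    [/\ f \is d.-homog, g \is d.-homog, P f, ~ P g & u = geval f / geval g].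

(* The closed subsets of X are the sets V(S). *)
Definition zero_locus (S : poly -> Prop) (P : point) : Prop :=
  forall f, S f -> P f.

Definition closed_set (Z : point -> Prop) : Prop :=
  exists S : poly -> Prop, forall P, Z P <-> zero_locus S P.

Definition strict_chain (d : nat) (c : 'I_d.+1 -> point) : Prop :=
  forall i j : 'I_d.+1, (i < j)%N ->
    (forall f, c i f -> c j f) /\ ~ (forall f, c j f -> c i f).

(* The Krull dimension of the local ring at P: the primes of that ring
   correspond to the points contained in P as ideals. *)
Definition local_dim (P : point) (d : nat) : Prop :=
  (exists2 c : 'I_d.+1 -> point, strict_chain c & c ord_max = P) /\
  (forall e (c : 'I_e.+1 -> point),
     strict_chain c -> c ord_max = P -> (e <= d)%N).

Definition regular_local (P : point) : Prop :=
  exists2 d, local_dim P d &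
  exists2 t : 'I_d -> F, (forall i, vanishes_at P (t i)) &
    forall u, vanishes_at P u ->
      exists2 a : 'I_d -> F, (forall i, regular_at P (a i)) &
        u = \sum_i a i * t i.

Definition nonsingular : Prop := forall P : point, regular_local P.

Definition alg_indep (d : nat) (y : 'I_d -> F) : Prop :=
  forall f : {mpoly K[d]}, mmap (cst X) y f = 0 -> f = 0.

(* dim X = d, as the transcendence degree of the function field *)
Definition has_dim (d : nat) : Prop :=
  (exists y : 'I_d -> F, alg_indep y) /\
  (forall y : 'I_d.+1 -> F, ~ alg_indep y).

(* Homogeneous coordinates of the points of X over an extension L of K. *)
Definition on_variety (L : fieldType) (h : {rmorphism K -> L})
    (a : 'I_(adim X).+1 -> L) : Prop :=
  (exists i, a i != 0) /\ (forall f : poly, vanishing f -> mmap h a f = 0).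

(* X(L) is irreducible in the Zariski topology of P^n(L), L an algebraic
   closure of K. *)
Definition geometrically_irreducible : Prop :=
  forall (L : alg_closure K) (d e : nat) (f g : {mpoly L[(adim X).+1]}),
    f \is d.-homog -> g \is e.-homog ->
    (forall a, on_variety (acl_in L) a -> f.@[a] = 0 \/ g.@[a] = 0) ->
    (forall a, on_variety (acl_in L) a -> f.@[a] = 0) \/
    (forall a, on_variety (acl_in L) a -> g.@[a] = 0).

(* f (x_0 T, ..., x_n T), whose coefficient of T^d is the value of the
   component of degree d of f. *)
Definition cone_eval (f : poly) : {poly F} :=
  mmap (polyC \o cst X) (fun i => (coord i)%:P * 'X) f.

Lemma coef_cone_eval f d : (cone_eval f)`_d = geval (pihomog mdeg d f).
Proof.
have mono m : mmap1 (fun i => (@coord K X i)%:P * 'X) m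
    = (mmap1 (@coord K X) m)%:P * 'X^(mdeg m).
  rewrite /mmap1 mdegE rmorph_prod (big_morph _ (exprD 'X) (expr0 'X)) -big_split /=.
  by apply: eq_bigr => i _; rewrite exprMn rmorphXn.
rewrite /cone_eval /geval pihomogE raddf_sum {1}/mmap coef_sum [RHS]big_mkcond.
apply: eq_bigr => m _; rewrite mono /= mulrA -polyCM coefCM coefXn eq_sym.
by case: eqP => _; rewrite ?mulr0 // mulr1 mmapZ mmapX.
Qed.

Lemma vanishingE f : vanishing f <-> cone_eval f = 0.
Proof.
split=> [f0|f0 d]; last by rewrite -coef_cone_eval f0 coef0.
by apply/polyP => d; rewrite coef0 coef_cone_eval f0.
Qed.

Lemma vanishing_homog d f : f \is d.-homog -> vanishing f <-> geval f = 0.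
Proof.
move=> hf; split=> [/(_ d)|f0 e]; first by rewrite pihomog_dE.
have [<-|ne] := eqVneq d e; first by rewrite pihomog_dE.
by rewrite (pihomog_ne0 ne hf) /geval raddf0.
Qed.

Lemma vanishing_point : is_point vanishing.
Proof.
split.
- by apply/vanishingE; rewrite /cone_eval raddf0.
- move=> f g /vanishingE f0 /vanishingE g0; apply/vanishingE.
  by rewrite /cone_eval raddfD /= -/(cone_eval f) -/(cone_eval g) f0 g0 addr0.
- move=> f g /vanishingE g0; apply/vanishingE.
  by rewrite /cone_eval rmorphM /= -/(cone_eval g) g0 mulr0.
- move=> d f f0; apply/(vanishing_homog (pihomogP _ _ _)); exact: f0.
- by move/vanishingE/eqP; rewrite /cone_eval rmorph1 oner_eq0.
- move=> f g /vanishingE /eqP; rewrite /cone_eval rmorphM mulf_eq0.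
  by case/orP=> /eqP ?; [left | right]; apply/vanishingE.
- by [].
- have [i xi] := coord_neq0 X; exists i => Xi0.
  have hX : ('X_i : poly) \is 1.-homog by rewrite dhomogX /= mdeg1.
  move: xi; have /(vanishing_homog hX) := Xi0.
  by rewrite /geval mmapX mmap1U => ->; rewrite eqxx.
Qed.

Definition generic : point := Point vanishing_point.

End Variety.

Arguments generic {K} X.
Arguments closed_set {K} X Z.
Arguments nonsingular {K} X.
Arguments has_dim {K} X d.
Arguments geometrically_irreducible {K} X.

Record curve (K : fieldType) := Curve {
  curve_variety :> variety K;
  curve_dim : has_dim curve_variety 1;
  curve_nonsingular : nonsingular curve_variety;
  curve_irreducible : geometrically_irreducible curve_variety
}.

Section Regular.
Variables (K : fieldType) (X : variety K).
Local Notation F := (funfield X).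
Implicit Types (P Q : point X) (u v : F).

Lemma point_geval P g d : g \is d.-homog -> ~ P g -> geval g != 0.
Proof.
move=> hg Pg; apply/eqP => g0; apply: Pg; apply: (point_on (pointP P)).
exact/(vanishing_homog hg).
Qed.

Lemma point_notM P f g : ~ P f -> ~ P g -> ~ P (f * g).
Proof. by move=> Pf Pg /(point_prime (pointP P)) []. Qed.

Lemma regular_generic u : regular_at (generic X) u.
Proof.
have [d [f [g [hf hg g0 ->]]]] := funfield_ratio u.
exists d, f, g; split=> // /(vanishing_homog hg) /eqP.
by rewrite (negbTE g0).
Qed.

Lemma regular_cst P (c : K) : regular_at P (cst X c).
Proof.
have h : (c%:MP : {mpoly K[(adim X).+1]}) \is 0.-homog.
  by rewrite -alg_mpolyC rpredZ // dhomog1.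
exists 0%N, c%:MP, 1; split; [exact: h | exact: dhomog1 | exact: (point1 (pointP P)) |].
by rewrite /geval mmapC rmorph1 divr1.
Qed.

Lemma regularB P u v : regular_at P u -> regular_at P v -> regular_at P (u - v).
Proof.
move=> [d [f [g [hf hg Pg ->]]]] [d' [f' [g' [hf' hg' Pg' ->]]]].
exists (d + d')%N, (f * g' - f' * g), (g * g'); split.
- by apply: rpredB; [exact: dhomogM | rewrite addnC; exact: dhomogM].
- exact: dhomogM.
- exact: point_notM.
- have := point_geval hg Pg; have := point_geval hg' Pg'.
  by rewrite /geval !(rmorphB, rmorphM) /= => g'0 g0; rewrite -[- (_ / _)]mulNr addf_div // mulNr.
Qed.

Lemma regularM P u v : regular_at P u -> regular_at P v -> regular_at P (u * v).
Proof.
move=> [d [f [g [hf hg Pg ->]]]] [d' [f' [g' [hf' hg' Pg' ->]]]].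
exists (d + d')%N, (f * f'), (g * g'); split; try exact: dhomogM.
- exact: point_notM.
- by rewrite /geval !rmorphM mulf_div.
Qed.

Lemma regular_vanishes P u : vanishes_at P u -> regular_at P u.
Proof. by move=> [d [f [g [hf hg _ Pg ->]]]]; exists d, f, g. Qed.

Lemma regular_specialize P Q u :
  (forall f, P f -> Q f) -> regular_at Q u -> regular_at P u.
Proof.
by move=> PQ [d [f [g [hf hg Qg ->]]]]; exists d, f, g; split=> // /PQ.
Qed.

Lemma generic_min P f : generic X f -> P f.
Proof. exact: (point_on (pointP P)). Qed.

End Regular.

(* A morphism of K-schemes C -> D: a continuous map on points and a map of
   sheaves.  The regular functions on a nonempty open set U of an integral scheme
   are the elements of the function field that are regular at all points of U, so
   the map of sheaves amounts to its stalk at the generic point of C.  This is a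
   homomorphism of K-algebras, defined on the local ring of D at the image of
   the generic point, which restricts to a local homomorphism from the local ring
   at the image of P to the local ring at P, for every P.  The function [s] is 0
   where this stalk is undefined, so that equality of morphisms is Leibniz
   equality (two morphisms with the same data are equal, see [kmorphism_eq]). *)
Record is_kmorphism (K : fieldType) (C D : variety K)
    (m : point C -> point D) (s : funfield D -> funfield C) : Prop :=
IsKMorphism {
  mor_continuous : forall Z, closed_set D Z -> closed_set C (fun P => Z (m P));
  mor_cst : forall c, s (cst D c) = cst C c;
  mor_sub : forall u v, regular_at (m (generic C)) u ->
    regular_at (m (generic C)) v -> s (u - v) = s u - s v;
  mor_mul : forall u v, regular_at (m (generic C)) u ->
    regular_at (m (generic C)) v -> s (u * v) = s u * s v;
  mor_regular : forall P u, regular_at (m P) u -> regular_at P (s u);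
  mor_local : forall P u, vanishes_at (m P) u -> vanishes_at P (s u);
  mor_undef : forall u, ~ regular_at (m (generic C)) u -> s u = 0
}.

Record kmorphism (K : fieldType) (C D : variety K) := KMorphism {
  on_points :> point C -> point D;
  pullback : funfield D -> funfield C;
  kmorphismP : is_kmorphism on_points pullback
}.

Section Category.
Variable K : fieldType.
Implicit Types A B C D : variety K.

Lemma kmorphism_eq C D (f g : kmorphism C D) :
  on_points f = on_points g -> pullback f = pullback g -> f = g.
Proof.
case: f g => [m s p] [m' s' p'] /= em es; subst m' s'.
by rewrite (Prop_irrelevance p p').
Qed.

Lemma kmorphism_specialize C D (f : kmorphism C D) (P : point C) u :
  regular_at (f P) u -> regular_at (f (generic C)) u.
Proof.
apply: regular_specialize => g.
have [S hS] := mor_continuous (kmorphismP f)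
  (ex_intro _ (f (generic C) : _ -> Prop) (fun Q => conj id id)).
have: zero_locus S P by move=> h /(proj1 (hS (generic C)) (fun _ => id)) /generic_min.
by move/(proj2 (hS P)); apply.
Qed.

Lemma id_is_kmorphism C : @is_kmorphism K C C id id.
Proof. by split=> // u /(_ (regular_generic u)). Qed.

Definition id_mor C : kmorphism C C := KMorphism (id_is_kmorphism C).

Section Composition.
Variables (B C D : variety K) (g : kmorphism C D) (f : kmorphism B C).

Definition comp_pullback (u : funfield D) : funfield B :=
  if `[< regular_at (g (f (generic B))) u >]
  then pullback f (pullback g u) else 0.

Lemma comp_pullbackE P u : regular_at (g (f P)) u ->
  comp_pullback u = pullback f (pullback g u).
Proof.
move=> hu; rewrite /comp_pullback asboolT //.
apply: (regular_specialize _ hu) => h.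
have [S hS] := mor_continuous (kmorphismP f) (mor_continuous (kmorphismP g)
  (ex_intro _ (g (f (generic B)) : _ -> Prop) (fun Q => conj id id))).
have: zero_locus S P by move=> k /(proj1 (hS (generic B)) (fun _ => id)) /generic_min.
by move/(proj2 (hS P)); apply.
Qed.

Lemma comp_is_kmorphism : is_kmorphism (g \o f) comp_pullback.
Proof.
have [fP gP] := (kmorphismP f, kmorphismP g).
have gen w : regular_at (g (f (generic B))) w -> regular_at (g (generic C)) w.
  exact: kmorphism_specialize.
split=> /=.
- by move=> Z /(mor_continuous gP) /(mor_continuous fP).
- move=> c; rewrite (comp_pullbackE (regular_cst (g (f (generic B))) c)).
  by rewrite (mor_cst gP) (mor_cst fP).
- move=> u v hu hv; rewrite !(@comp_pullbackE (generic B)) //; last exact: regularB.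
  rewrite (mor_sub gP); try exact: gen.
  by rewrite (mor_sub fP) //; apply: (mor_regular gP).
- move=> u v hu hv; rewrite !(@comp_pullbackE (generic B)) //; last exact: regularM.
  rewrite (mor_mul gP); try exact: gen.
  by rewrite (mor_mul fP) //; apply: (mor_regular gP).
- move=> P u hu; rewrite (comp_pullbackE hu).
  exact/(mor_regular fP)/(mor_regular gP).
- move=> P u hu; rewrite (comp_pullbackE (regular_vanishes hu)).
  exact/(mor_local fP)/(mor_local gP).
- by move=> u hu; rewrite /comp_pullback asboolF.
Qed.

Definition comp_mor : kmorphism B D := KMorphism comp_is_kmorphism.

End Composition.

Local Notation "g \oM f" := (comp_mor g f) (at level 50, left associativity).

Lemma comp_morA A B C D (h : kmorphism C D) (g : kmorphism B C) (f : kmorphism A B) :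
  h \oM (g \oM f) = (h \oM g) \oM f.
Proof.
apply: kmorphism_eq => //; apply/funext => u /=.
have [hu|hu] := pselect (regular_at (h (g (f (generic A)))) u); last first.
  by rewrite (mor_undef (comp_is_kmorphism _ _)) // (mor_undef (comp_is_kmorphism _ _)).
rewrite (comp_pullbackE (g := h) (f := g \oM f) (P := generic A)) //.
rewrite (comp_pullbackE (g := h \oM g) (f := f) (P := generic A)) //=.
rewrite (comp_pullbackE (g := g) (P := generic A)); last exact: (mor_regular (kmorphismP h)).
by rewrite (comp_pullbackE (P := f (generic A))).
Qed.

Lemma comp_mor1 C D (f : kmorphism C D) : f \oM id_mor C = f.
Proof.
apply: kmorphism_eq => //; apply/funext => u /=.
rewrite /comp_pullback; case: asboolP => //= hu.
by rewrite (mor_undef (kmorphismP f)).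
Qed.

Lemma comp_1mor C D (f : kmorphism C D) : id_mor D \oM f = f.
Proof.
apply: kmorphism_eq => //; apply/funext => u /=.
rewrite /comp_pullback; case: asboolP => //= hu.
by rewrite (mor_undef (kmorphismP f)).
Qed.

End Category.

Notation "g \oM f" := (comp_mor g f) (at level 50, left associativity).

Record cover_aut (K : fieldType) (C D : variety K) (phi : kmorphism C D) := CoverAut {
  aut_mor :> kmorphism C C;
  aut_inv : kmorphism C C;
  aut_invr : aut_mor \oM aut_inv = id_mor C;
  aut_invl : aut_inv \oM aut_mor = id_mor C;
  aut_over : phi \oM aut_mor = phi
}.

Section AutGroup.
Variables (K : fieldType) (C D : variety K) (phi : kmorphism C D).
Implicit Types a b c : cover_aut phi.

Lemma aut_eq a b : aut_mor a = aut_mor b -> a = b.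
Proof.
case: a b => [m i r l o] [m' i' r' l' o'] /= e; subst m'.
have e : i = i' by rewrite -[i]comp_mor1 -r' comp_morA l comp_1mor.
by subst i'; congr CoverAut; exact: Prop_irrelevance.
Qed.

Definition aut_id : cover_aut phi :=
  CoverAut (comp_mor1 (id_mor C)) (comp_mor1 (id_mor C)) (comp_mor1 phi).

Lemma aut_comp_invr a b : (a \oM b) \oM (aut_inv b \oM aut_inv a) = id_mor C.
Proof. by rewrite comp_morA -(comp_morA a) aut_invr comp_mor1 aut_invr. Qed.

Lemma aut_comp_invl a b : (aut_inv b \oM aut_inv a) \oM (a \oM b) = id_mor C.
Proof.
by rewrite comp_morA -(comp_morA (aut_inv b)) aut_invl comp_mor1 aut_invl.
Qed.

Lemma aut_comp_over a b : phi \oM (a \oM b) = phi.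
Proof. by rewrite comp_morA !aut_over. Qed.

Definition aut_comp a b : cover_aut phi :=
  CoverAut (aut_comp_invr a b) (aut_comp_invl a b) (aut_comp_over a b).

Lemma aut_inv_over a : phi \oM aut_inv a = phi.
Proof. by rewrite -{1}(aut_over a) -comp_morA aut_invr comp_mor1. Qed.

Definition aut_inverse a : cover_aut phi := CoverAut (aut_invl a) (aut_invr a) (aut_inv_over a).

HB.instance Definition _ := gen_eqMixin (cover_aut phi).
HB.instance Definition _ := gen_choiceMixin (cover_aut phi).

Fact aut_compA : associative aut_comp.
Proof. by move=> a b c; apply: aut_eq; apply: comp_morA. Qed.

Fact aut_comp1 : right_id aut_id aut_comp.
Proof. by move=> a; apply: aut_eq; apply: comp_mor1. Qed.

Fact aut_1comp : left_id aut_id aut_comp.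
Proof. by move=> a; apply: aut_eq; apply: comp_1mor. Qed.

Fact aut_compV : right_inverse aut_id aut_inverse aut_comp.
Proof. by move=> a; apply: aut_eq; apply: aut_invr. Qed.

Fact aut_compVl : left_inverse aut_id aut_inverse aut_comp.
Proof. by move=> a; apply: aut_eq; apply: aut_invl. Qed.

HB.instance Definition _ := isGroup.Build (cover_aut phi)
  aut_compA aut_1comp aut_comp1 aut_compVl aut_compV.

End AutGroup.

Section Covers.
Variables (K : fieldType) (C D : variety K).

Definition nonconstant (phi : kmorphism C D) : Prop :=
  exists P Q : point C, phi P <> phi Q.

(* e is the embedding of K(D) in K(C) given by phi. *)
Definition function_field_embedding (phi : kmorphism C D)
    (e : {rmorphism funfield D -> funfield C}) : Prop :=
  forall u, pullback phi u = e u.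

Definition separable_extension (k E : fieldType) (e : {rmorphism k -> E}) : Prop :=
  forall w : E, exists2 p : {poly k}, separable_poly p & root (map_poly e p) w.

Definition is_cover (phi : kmorphism C D) : Prop :=
  nonconstant phi /\
  exists2 e, function_field_embedding phi e & separable_extension e.

End Covers.

Section Monodromy.
Variables (k E : fieldType) (e : {rmorphism k -> E}) (Omega : alg_closure k).

(* A Galois closure of E / k, in the algebraic closure Omega of k. *)
Record galois_closure := GaloisClosure {
  gcl :> splittingFieldType k;
  gcl_emb : {rmorphism E -> gcl};
  gcl_in : {rmorphism gcl -> Omega};
  gcl_embE : forall a, gcl_emb (e a) = a%:A;
  gcl_inE : forall a, gcl_in a%:A = acl_in Omega a;
  gcl_galois : galois 1 {:gcl};
  gcl_minimal : forall M : {subfield gcl},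
    galois 1 M -> (forall u, gcl_emb u \in M) -> M = {:gcl}%VS :> {vspace gcl}
}.

Definition mon (N : galois_closure) : {group gal_of {:N}} := 'Gal({:N} / 1)%G.

Definition is_embedding (s : {rmorphism E -> Omega}) : Prop :=
  forall a, s (e a) = acl_in Omega a.

(* The action of the monodromy group on the embeddings of E in Omega, by
   composition: g maps s to t.  *)
Definition mon_maps (N : galois_closure) (g : gal_of {:N})
    (s t : {rmorphism E -> Omega}) : Prop :=
  forall u, exists2 v : N, s u = gcl_in N v & t u = gcl_in N (g v).

Definition mon_transitive (N : galois_closure) (H : {set gal_of {:N}}) : Prop :=
  forall s t, is_embedding s -> is_embedding t ->
    exists2 g, g \in H & mon_maps g s t.

End Monodromy.

Definition dedekind (gT : finGroupType) (H : {set gT}) : Prop :=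
  forall J : {group gT}, J \subset H -> (J <| H)%g.

(* Main.v *)
(* An automorphism of psi acts on K(C) over K(D).  By the Dedekind hypothesis
   this action preserves the subfield K(C_1), because it is induced by an
   element of H, which normalizes the subgroup of H fixing K(C_1).  It remains
   to turn an automorphism of K(C_1) into a morphism of curves.  The local rings
   of a nonsingular curve are valuation rings, so a point of C_1 is sent to the
   center, on the projective variety C_1, of the transported valuation ring.
   A dominant morphism is determined by its action on function fields, which
   gives the uniqueness and the compatibility with composition. *)

Require Import Defs.
From HB Require Import structures.
From mathcomp Require Import all_boot all_order all_fingroup all_algebra all_field.
From mathcomp Require Import boolp mpoly.

Set Implicit Arguments.
Unset Strict Implicit.
Unset Printing Implicit Defensive.

(** * Automorphisms of field extensions with a transitive Dedekind group *)

Section ImageSubfield.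
Import GRing.Theory.
Local Open Scope ring_scope.
Variables (k : fieldType) (L : falgType k) (P : L -> Prop).

(** Among the subspaces contained in [P], take one of maximal dimension: adjoining the line of any
    [w] with [P w] stays inside [P], so it cannot enlarge the subspace. *)
Lemma vspace_of_submod : P 0 -> (forall a u v, P u -> P v -> P (a *: u + v)) ->
  exists U : {vspace L}, forall w, w \in U <-> P w.
Proof.
move=> P0 Plin.
pose Q n := `[< exists2 U : {vspace L}, \dim U = n & forall w, w \in U -> P w >].
have exQ : exists n, Q n.
  exists 0; apply/asboolP; exists 0%VS; first exact: dimv0.
  by move=> w; rewrite memv0 => /eqP->.
have boundQ n : Q n -> (n <= \dim {:L})%N.
  by move=> /asboolP[U <- _]; apply/dimvS/subvf.
case: (ex_maxnP exQ boundQ) => n /asboolP[U dimU PU] maxU.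
exists U => w; split=> [/PU //|Pw].
have /asboolP/maxU : exists2 W : {vspace L}, \dim W = \dim (U + <[w]>)%VS & forall v, v \in W -> P v.
  exists (U + <[w]>)%VS => // v /memv_addP[x /PU Px [y /vlineP[a ->] ->]].
  by rewrite addrC; apply: Plin.
rewrite -dimU => le_dim.
have /eqP-> : U == (U + <[w]>)%VS by rewrite eqEdim addvSl.
by apply: (subvP (addvSr _ _)); rewrite memv_line.
Qed.

End ImageSubfield.

(** This puts the image of [F] in the form required by the Galois correspondence. Since [L] is
    finite over [k], a subspace with a unit that is closed under products is a subfield. *)
Lemma image_subfield (k F : fieldType) (L : fieldExtType k)
    (i : {rmorphism k -> F}) (j : {rmorphism F -> L}) :
  (forall a, j (i a) = (a%:A)%R) ->
  exists E : {subfield L}, forall w, w \in E <-> exists x, w = j x.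
Proof.
move=> jE.
have [||U hU] := @vspace_of_submod k L (fun w => exists x, w = j x).
- by exists 0%R; rewrite GRing.rmorph0.
- move=> a _ _ [x ->] [y ->]; exists (i a * x + y)%R.
  by rewrite GRing.rmorphD GRing.rmorphM jE GRing.mulr_algl.
have aU : is_aspace U.
  apply/andP; split.
    by apply/has_algid1/hU; exists 1%R; rewrite GRing.rmorph1.
  apply/prodvP => _ _ /hU[x ->] /hU[y ->]; apply/hU.
  by exists (x * y)%R; rewrite GRing.rmorphM.
by exists (ASpace aU).
Qed.

Section DedekindInvariance.
Import GRing.Theory.
Local Open Scope ring_scope.
Variables (k E F : fieldType) (e : {rmorphism k -> E}) (Omega : alg_closure k).
Variables (N : galois_closure e Omega) (H : {group gal_of (fullv : {vspace N})}).
Hypotheses (H_transitive : mon_transitive H) (H_dedekind : dedekind H).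
Variables (i : {rmorphism k -> F}) (j : {rmorphism F -> E}).
Hypothesis jE : forall a, j (i a) = e a.

(** Transitivity is a statement about embeddings into [Omega], so [f] and [gcl_emb N] are both
    composed with [gcl_in N], whose injectivity then brings the result back to [N]. *)
Lemma embedding_lift (f : {rmorphism E -> N}) :
  (forall a, f (e a) = a%:A) -> exists2 h, h \in H & forall u, h (gcl_emb N u) = f u.
Proof.
move=> fE.
pose s : {rmorphism E -> Omega} := gcl_in N \o gcl_emb N.
pose t : {rmorphism E -> Omega} := gcl_in N \o f.
have [||h hH hst] := H_transitive (s := s) (t := t).
- by move=> a; rewrite /s /= gcl_embE gcl_inE.
- by move=> a; rewrite /t /= fE gcl_inE.
exists h => // u; have [v] := hst u.
by rewrite /s /t /= => /fmorph_inj-> /fmorph_inj->.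
Qed.

(** By the Galois correspondence, being fixed by all of Gal(N/F) is enough. Each element of that
    group agrees on [E] with some element of [H], which therefore also fixes [F]. *)
Lemma fixed_by_subgroup_image u :
  (forall g, g \in H -> (forall x, g (gcl_emb N (j x)) = gcl_emb N (j x)) ->
     g (gcl_emb N u) = gcl_emb N u) ->
  exists x, u = j x.
Proof.
move=> fixu.
have ijE a : (gcl_emb N \o j) (i a) = a%:A by rewrite /= jE gcl_embE.
have [E1 hE1] := image_subfield ijE.
have galE1 : galois E1 {:N}.
  by apply: galoisS (gcl_galois N); rewrite sub1v subvf.
suff : gcl_emb N u \in E1 by move=> /hE1[x /= /fmorph_inj]; exists x.
rewrite -(galois_fixedField galE1); apply/fixedFieldP; first exact: memvf.
move=> g gE1.
have fixg x : g (gcl_emb N (j x)) = gcl_emb N (j x).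
  by apply: (fixed_gal (subvf _) gE1); apply/hE1; exists x.
pose f : {rmorphism E -> N} := (g : {rmorphism N -> N}) \o gcl_emb N.
have [|h hH hf] := @embedding_lift f.
  by move=> a; rewrite /f /= gcl_embE rmorph_alg.
have -> : g (gcl_emb N u) = h (gcl_emb N u) by rewrite hf.
by apply: fixu => // x; rewrite hf /f /= fixg.
Qed.

(* An automorphism of E over k is induced by some h in H.  The subgroup J of H
   fixing F pointwise is normal in H, so h preserves the fixed field of J, and
   the fixed field of J meets E in F because H already realizes all embeddings
   of E over F. *)
Lemma automorphism_preserves_image (sigma : {rmorphism E -> E}) :
  (forall a, sigma (e a) = e a) -> forall x, exists y, sigma (j x) = j y.
Proof.
move=> sigmaE x.
pose f : {rmorphism E -> N} := gcl_emb N \o sigma.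
have [|h hH hf] := @embedding_lift f; first by move=> a; rewrite /f /= sigmaE gcl_embE.
pose J := [set g in H | `[< forall x, g (gcl_emb N (j x)) = gcl_emb N (j x) >]].
have gJ : group_set J.
  apply/group_setP; split=> [|g g'].
    by rewrite inE group1; apply/asboolP => y; rewrite gal_id.
  rewrite !inE => /andP[gH /asboolP gJ] /andP[gH' /asboolP gJ'].
  rewrite groupM //; apply/asboolP => y.
  by rewrite galM ?memvf // gJ gJ'.
have JH : J \subset H by apply/subsetP=> g; rewrite inE => /andP[].
have nJ := @H_dedekind (group gJ) JH.
apply: fixed_by_subgroup_image => g gH fixg.
have gJ0 : g \in J by rewrite inE gH; apply/asboolP.
(* Products in the Galois group act from left to right, so that [g ^ h^-1] is [h], then [g], then
   the inverse of [h]; that it fixes [F] means that [g] fixes the image of [F] under [h]. *)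
have : (g ^ h^-1)%g \in J by rewrite memJ_norm // groupV; exact: (subsetP (normal_norm nJ)).
rewrite inE => /andP[_ /asboolP/(_ x)] gx.
have -> : gcl_emb N (sigma (j x)) = h (gcl_emb N (j x)) by rewrite hf.
rewrite -[in RHS]gx -!galM ?memvf //.
by rewrite conjgE invgK mulgA mulgKV.
Qed.

End DedekindInvariance.

(** * Local rings *)

Section LocalRing.
Import GRing.Theory.
Local Open Scope ring_scope.
Variables (K : fieldType) (X : variety K).
Local Notation F := (funfield X).
Implicit Types (P Q : point X) (u v : F).

Lemma regular1 P : regular_at P 1.
Proof. by rewrite -(rmorph1 (cst X)); exact: regular_cst. Qed.

Lemma regular0 P : regular_at P 0.
Proof. by rewrite -(rmorph0 (cst X)); exact: regular_cst. Qed.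

Lemma regularN P u : regular_at P u -> regular_at P (- u).
Proof. by move=> hu; rewrite -sub0r; apply: regularB => //; exact: regular0. Qed.

Lemma regularD P u v : regular_at P u -> regular_at P v -> regular_at P (u + v).
Proof. by move=> hu hv; rewrite -[v]opprK; apply/regularB/regularN. Qed.

Lemma regularX P u n : regular_at P u -> regular_at P (u ^+ n).
Proof.
move=> hu; elim: n => [|n IH]; first by rewrite expr0; exact: regular1.
by rewrite exprS; exact: regularM.
Qed.

(** If (f/g)(a/b) = 1, then fa - gb vanishes on X and hence lies in P. With f in P this puts gb in
    P, against primality. *)
Lemma vanishes_mulN1 P u v : vanishes_at P u -> regular_at P v -> u * v <> 1.
Proof.
move=> [d [f [g [hf hg Pf Pg ->]]]] [d' [a [b [ha hb Pb ->]]]] uv1.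
have gn0 := point_geval hg Pg; have bn0 := point_geval hb Pb.
have eq0 : geval (f * a - g * b) = 0.
  apply/eqP; rewrite /geval rmorphB !rmorphM /= subr_eq0 -/(geval _) -!/(geval _).
  by rewrite -[_ * _](divfK (mulf_neq0 gn0 bn0)) -mulf_div uv1 mul1r.
apply: (point_notM Pg Pb).
have -> : g * b = f * a - (f * a - g * b) by rewrite opprB addrC subrK.
apply: (pointD (pointP P)); first by rewrite mulrC; apply: (pointM (pointP P)).
rewrite -mulN1r; apply: (pointM (pointP P)); apply: (point_on (pointP P)).
have hom : f * a - g * b \is (d + d').-homog by rewrite rpredB // dhomogM.
exact/(vanishing_homog hom).
Qed.

Lemma regular_invr P u : regular_at P u -> ~ vanishes_at P u -> regular_at P u^-1.
Proof.
move=> [d [f [g [hf hg Pg ->]]]] nv; exists d, g, f; split=> //; last by rewrite invf_div.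
by move=> Pf; apply: nv; exists d, f, g.
Qed.

Lemma vanishes0 P : vanishes_at P 0.
Proof.
exists 0%N, 0, 1; split; [exact: rpred0 | exact: dhomog1 | exact: point0 (pointP P) |
  exact: point1 (pointP P) |].
by rewrite /geval rmorph0 mul0r.
Qed.

(** The maximal ideal as the set of nonunits, which allows later arguments to avoid polynomials.
    Zero is listed apart because 0^-1 = 0 counts as regular. *)
Lemma vanishesE P u : vanishes_at P u <-> regular_at P u /\ (u = 0 \/ ~ regular_at P u^-1).
Proof.
split=> [hu|[hu [->|hV]]]; last 2 first.
- exact: vanishes0.
- by have [//|nu] := pselect (vanishes_at P u); case: hV; exact: regular_invr.
split; first exact: regular_vanishes.
have [->|u0] := eqVneq u 0; [by left | right => hV].
by case: (vanishes_mulN1 hu hV); rewrite divff.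
Qed.

Lemma vanishesM P u v : regular_at P u -> vanishes_at P v -> vanishes_at P (u * v).
Proof.
move=> hu hv; have hr := regular_vanishes hv; apply/vanishesE; split; first exact: regularM.
have [->|n0] := eqVneq (u * v) 0; [by left | right => hV].
by case: (vanishes_mulN1 hv (regularM hu hV)); rewrite mulrA [v * u]mulrC divff.
Qed.

Lemma vanishes1 P : ~ vanishes_at P 1.
Proof. by move=> h; case: (vanishes_mulN1 h (regular1 P)); rewrite mulr1. Qed.

Lemma vanishesD P u v : vanishes_at P u -> vanishes_at P v -> vanishes_at P (u + v).
Proof.
move=> [d [f [g [hf hg Pf Pg ->]]]] [d' [a [b [ha hb Pa Pb ->]]]].
exists (d + d')%N, (f * b + a * g), (g * b); split.
- by apply: rpredD; [exact: dhomogM | rewrite addnC; exact: dhomogM].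
- exact: dhomogM.
- apply: (pointD (pointP P)); rewrite mulrC; exact: (pointM (pointP P)).
- exact: point_notM.
- have := point_geval hg Pg; have := point_geval hb Pb.
  by rewrite /geval !(rmorphD, rmorphM) /= => b0 g0; rewrite addf_div.
Qed.

Lemma vanishes_prime P u v : regular_at P u -> regular_at P v ->
  vanishes_at P (u * v) -> vanishes_at P u \/ vanishes_at P v.
Proof.
move=> hu hv huv; have [|nu] := pselect (vanishes_at P u); [by left | right].
have u0 : u != 0 by apply: contra_notN nu => /eqP->; exact: vanishes0.
have -> : v = u^-1 * (u * v) by rewrite mulKf.
by apply: vanishesM => //; exact: regular_invr.
Qed.

Lemma vanishes_generic u : vanishes_at (generic X) u <-> u = 0.
Proof.
split=> [|->]; last exact: vanishes0.
by move=> /vanishesE[_ [//|]]; case; exact: regular_generic.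
Qed.

Lemma homog_X (i : 'I_(adim X).+1) : ('X_i : {mpoly K[(adim X).+1]}) \is 1.-homog.
Proof. by rewrite dhomogX /= mdeg1. Qed.

Lemma homog_Xn (i : 'I_(adim X).+1) d :
  ('X_i ^+ d : {mpoly K[(adim X).+1]}) \is d.-homog.
Proof. by rewrite -[X in X.-homog]mul1n dhomogMn ?homog_X. Qed.

Lemma geval_Xn (i : 'I_(adim X).+1) d : geval ('X_i ^+ d) = Defs.coord i ^+ d.
Proof. by rewrite /geval rmorphXn /= mmapX mmap1U. Qed.

Lemma point_notXn P (i : 'I_(adim X).+1) d : ~ P 'X_i -> ~ P ('X_i ^+ d).
Proof.
move=> Pi; elim: d => [|d IH]; first by rewrite expr0; exact: (point1 (pointP P)).
by rewrite exprS; exact: point_notM.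
Qed.

Lemma coord_neq0_at P (i : 'I_(adim X).+1) : ~ P 'X_i -> Defs.coord i != 0.
Proof. by move=> Pi; have := point_geval (homog_X i) Pi; rewrite -['X_i]expr1 geval_Xn. Qed.

Lemma regular_dehomog P i d f : ~ P 'X_i -> f \is d.-homog ->
  regular_at P (geval f / Defs.coord i ^+ d).
Proof.
move=> Pi hf; exists d, f, ('X_i ^+ d); split=> //; rewrite ?homog_Xn ?geval_Xn //.
exact: point_notXn.
Qed.

(** A point is recovered from its local ring through any chart containing it: if f is not in P, then
    x_i^d / f is regular at P and inverts the dehomogenized f. *)
Lemma vanishes_dehomog P i d f : ~ P 'X_i -> f \is d.-homog ->
  vanishes_at P (geval f / Defs.coord i ^+ d) <-> P f.
Proof.
move=> Pi hf; split=> [hv|Pf]; last first.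
  exists d, f, ('X_i ^+ d); split=> //; rewrite ?homog_Xn ?geval_Xn //.
  exact: point_notXn.
have [//|nPf] := pselect (P f).
have r : regular_at P (Defs.coord i ^+ d / geval f).
  by exists d, ('X_i ^+ d), f; split=> //; rewrite ?homog_Xn ?geval_Xn.
case: (vanishes_mulN1 hv r); rewrite mulf_div [geval f * _]mulrC divff // mulf_neq0 //.
  by rewrite expf_neq0 // (coord_neq0_at Pi).
exact: point_geval hf nPf.
Qed.

Lemma regular_fraction P u : exists a b, [/\ regular_at P a, regular_at P b, b != 0 & u = a / b].
Proof.
have [d [f [g [hf hg g0 ->]]]] := funfield_ratio u.
have [i Pi] := point_relevant (pointP P).
have xi0 := coord_neq0_at Pi.
exists (geval f / Defs.coord i ^+ d), (geval g / Defs.coord i ^+ d).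
split; rewrite ?mulf_neq0 ?invr_eq0 ?expf_neq0 //; try exact: regular_dehomog.
by rewrite invf_div mulrA divfK ?expf_neq0.
Qed.

Lemma point_homogP P f : P f <-> forall d, P (pihomog mdeg d f).
Proof.
split=> [Pf d|Pf]; first exact: (point_homog (pointP P)).
rewrite (pihomog_partitionE (leqnn (mmeasure mdeg f))).
by elim/big_ind: _ => //; [exact: point0 (pointP P) | exact: pointD (pointP P)].
Qed.

End LocalRing.

(** * Local rings of nonsingular curves are valuation rings *)

Section TranscendenceDegree.
Import GRing.Theory.
Local Open Scope ring_scope.
Variables (K : fieldType) (X : variety K).
Local Notation F := (funfield X).
Implicit Types (P Q : point X) (u v : F).

(* An algebraic relation f(x, y) = 0 is divided by its lexicographically
   smallest monomial x^k y^l. *)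
Lemma algebraic_relation P x y : has_dim X 1 -> x != 0 ->
  regular_at P x -> regular_at P y ->
  exists l r1 r2, [/\ regular_at P r1, regular_at P r2 & y ^+ l = y ^+ l.+1 * r1 + x * r2].
Proof.
move=> [_ indep] x0 hx hy.
have dep := indep (fun i : 'I_2 => if i == 0 :> nat then x else y).
have [f f0 fn0] : exists2 f : {mpoly K[2]},
    mmap (cst X) (fun i : 'I_2 => if i == 0 :> nat then x else y) f = 0 & f != 0.
  apply: contra_notP dep => no f f0; have [//|fn0] := eqVneq f 0.
  by case: no; exists f.
pose a (m : 'X_{1..2}) := m ord0; pose b (m : 'X_{1..2}) := m ord_max.
have m1E m : mmap1 (fun i : 'I_2 => if i == 0 :> nat then x else y) m = x ^+ a m * y ^+ b m.
  rewrite /mmap1 big_ord_recl big_ord1 /=; congr (_ * y ^+ m _); exact: val_inj.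
have [k hk mink] : exists2 k, has (fun m => a m == k) (msupp f) &
    forall m, m \in msupp f -> (k <= a m)%N.
  have ex : exists k, has (fun m => a m == k) (msupp f).
    by exists (a (mlead f)); apply/hasP; exists (mlead f); rewrite ?mlead_supp.
  case: (ex_minnP ex) => k hk mink; exists k => // m hm.
  by apply: mink; apply/hasP; exists m.
have [m0 m0f [am0 minl0]] : exists2 m0, m0 \in msupp f & a m0 = k /\
    forall m, m \in msupp f -> a m = k -> (b m0 <= b m)%N.
  have ex : exists l, has (fun m => (a m == k) && (b m == l)) (msupp f).
    by have /hasP[m mf am] := hk; exists (b m); apply/hasP; exists m => //; rewrite am eqxx.
  case: (ex_minnP ex) => l /hasP[m0 m0f /andP[/eqP am0 /eqP bm0]] minl.
  exists m0 => //; split=> // m mf am; rewrite bm0; apply: minl; apply/hasP.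
  by exists m => //; rewrite am !eqxx.
pose l := b m0; pose c := cst X f@_m0.
have c0 : c != 0 by rewrite fmorph_eq0 -mcoeff_msupp.
(* By the choice of [m0], every other monomial either has x-exponent k and y-exponent above l, and
   goes into [r1], or has x-exponent above k, and goes into [r2]. *)
have [r1 [r2 [hr1 hr2 e]]] : exists r1 r2, [/\ regular_at P r1, regular_at P r2 &
    \sum_(m <- msupp f | m != m0) cst X f@_m * mmap1 (fun i : 'I_2 => if i == 0 :> nat then x else y) m
    = x ^+ k * (y ^+ l.+1 * r1 + x * r2)].
  rewrite big_seq_cond.
  elim/big_ind: _ => [|u v [r1 [r2 [h1 h2 ->]]] [s1 [s2 [g1 g2 ->]]]|m /andP[mf nm]].
  - by exists 0, 0; split; try exact: regular0; rewrite !mulr0 addr0 mulr0.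
  - exists (r1 + s1), (r2 + s2); split; try exact: regularD.
    by rewrite -mulrDr addrACA -!mulrDr.
  rewrite m1E; have [am|am] := eqVneq (a m) k.
    have lb : (l < b m)%N.
      rewrite ltn_neqAle (minl0 _ mf am) andbT; apply: contra_neq nm => bm.
      apply/mnmP => i; case: (unliftP ord0 i) => [j ->|->]; last by rewrite -/(a m) am.
      rewrite [lift _ _](_ : _ = ord_max) //.
      by apply: val_inj; rewrite /= ord1.
    exists (cst X f@_m * y ^+ (b m - l.+1)), 0; split.
    - by apply: regularM; [exact: regular_cst | exact: regularX].
    - exact: regular0.
    - rewrite am mulr0 addr0 mulrCA; congr (_ * _).
      by rewrite mulrCA -exprD subnKC.
  have ka : (k < a m)%N by rewrite ltn_neqAle eq_sym am mink.
  exists 0, (cst X f@_m * (x ^+ (a m - k.+1) * y ^+ b m)); split.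
  - exact: regular0.
  - by apply: regularM; [exact: regular_cst | apply: regularM; exact: regularX].
  - have -> : x ^+ a m = x ^+ k * (x * x ^+ (a m - k.+1)).
      by rewrite -exprS -exprD addnS -addSn subnKC.
    by rewrite mulr0 add0r -!mulrA mulrCA [X in _ * X]mulrCA.
move: f0; rewrite /mmap (bigD1_seq m0) //= e m1E am0 -/c -/l mulrCA -mulrDr.
move=> /eqP; rewrite mulf_eq0 expf_eq0 (negbTE x0) andbF /= => /eqP eq0.
exists l, (- c^-1 * r1), (- c^-1 * r2).
have hc : regular_at P (- c^-1).
  by rewrite /c -fmorphV; apply/regularN/regular_cst.
split; try exact: regularM.
rewrite mulrCA [x * _]mulrCA -mulrDr -[X in _ * X](addKr (c * y ^+ l)) eq0 addr0.
by rewrite mulrNN mulKf.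
Qed.

(** Pick x nonzero vanishing at [c1], and y vanishing at [c2] but not at [c1]. Their algebraic
    relation makes a power of y vanish at [c1], which contradicts primality. *)
Lemma no_chain2 (c0 c1 c2 : point X) : has_dim X 1 ->
  (forall f, c1 f -> c2 f) -> ~ (forall f, c1 f -> c0 f) -> ~ (forall f, c2 f -> c1 f) -> False.
Proof.
move=> dim1 c12 nc10 nc21.
have [i c2i] := point_relevant (pointP c2).
have c1i : ~ c1 'X_i by move/c12.
have homog_gap (p q : point X) : ~ (forall f, q f -> p f) ->
    exists d f, [/\ f \is d.-homog, q f & ~ p f].
  move=> npq; apply: contra_notP npq => no f qf; apply/point_homogP => d.
  have [//|npf] := pselect (p (pihomog mdeg d f)); case: no.
  exists d, (pihomog mdeg d f); split=> //; first exact: pihomogP.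
  exact: (point_homog (pointP q)).
have [d [f [hf c1f c0f]]] := homog_gap _ _ nc10.
have [d' [g [hg c2g c1g]]] := homog_gap _ _ nc21.
pose x := geval f / Defs.coord i ^+ d; pose y := geval g / Defs.coord i ^+ d'.
have x0 : x != 0.
  by rewrite mulf_neq0 ?(point_geval hf c0f) // invr_eq0 expf_neq0 // (coord_neq0_at c2i).
have v1x : vanishes_at c1 x by apply/vanishes_dehomog.
have v2y : vanishes_at c2 y by apply/vanishes_dehomog.
have n1y : ~ vanishes_at c1 y by move=> /(vanishes_dehomog c1i hg).
have r2x : regular_at c2 x by exact: regular_dehomog.
have r2y := regular_vanishes v2y.
have [l [r1 [r2 [hr1 hr2 e]]]] := algebraic_relation dim1 x0 r2x r2y.
have sp u : regular_at c2 u -> regular_at c1 u by exact: regular_specialize.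
have r1y := sp _ r2y.
(* The relation reads y^l (1 - y r1) = x r2, where 1 - y r1 is a unit at [c2] because y vanishes
   there. *)
have yl : vanishes_at c1 (y ^+ l).
  have w0 : ~ vanishes_at c2 (1 - y * r1).
    move=> /vanishesD /(_ (vanishesM hr1 v2y)); rewrite [r1 * y]mulrC subrK.
    exact: vanishes1.
  have w1 : regular_at c2 (1 - y * r1)^-1.
    by apply: regular_invr w0; apply: regularB; [exact: regular1 | exact: regularM].
  have wn0 : 1 - y * r1 != 0 by apply: contra_notN w0 => /eqP->; exact: vanishes0.
  have -> : y ^+ l = ((1 - y * r1)^-1 * r2) * x.
    apply: (mulfI wn0); rewrite -[_^-1 * _ * x]mulrA mulVKf // [r2 * x]mulrC mulrBl mul1r.
    by rewrite {1}e -[y * r1 * _]mulrA [r1 * _]mulrC mulrA -exprS addrC addKr.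
  by apply: vanishesM => //; apply: regularM; apply: sp.
elim: l {e} yl => [|l IH]; first by rewrite expr0; exact: vanishes1.
by rewrite exprS => /vanishes_prime[] //; exact: regularX.
Qed.

(** A case of Krull's intersection theorem, obtained from the relation t^l = t^(l+1) r1 + x r2:
    substituting x = t^(l+1) r and cancelling t^l makes t a unit. *)
Lemma infinitely_divisible_eq0 P t x : has_dim X 1 -> t != 0 -> vanishes_at P t ->
  (forall n, exists2 r, regular_at P r & x = t ^+ n * r) -> x = 0.
Proof.
move=> dim1 t0 vt div; apply/eqP; apply: contraT => x0.
have hx : regular_at P x by have [r hr ->] := div 0; rewrite expr0 mul1r.
have [l [r1 [r2 [hr1 hr2 e]]]] := algebraic_relation dim1 x0 hx (regular_vanishes vt).
have [r hr xE] := div l.+1.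
have hs : regular_at P (r1 + r * r2) by apply: regularD => //; exact: regularM.
case: (vanishes_mulN1 vt hs); apply: (mulfI (expf_neq0 l t0)).
by rewrite mulr1 [RHS]e xE mulrA -exprSr mulrDr mulrA.
Qed.

(* The maximal ideal is generated by at most one element t, because a longer
   chain of points would give two algebraically independent functions; and no
   nonzero function is divisible by all powers of t. *)
Lemma local_ring_valuation P u : has_dim X 1 -> nonsingular X ->
  regular_at P u \/ regular_at P u^-1.
Proof.
move=> dim1 /(_ P) [d [[c cP _] _] [t ht gen]].
have d2 : (d < 2)%N.
  rewrite ltnNge; apply/negP => d2.
  pose o n := inord n : 'I_d.+1.
  have lt01 : (o 0 < o 1)%N by rewrite !inordK // ltnS ltnW.
  have lt12 : (o 1 < o 2)%N by rewrite !inordK // ltnS ltnW.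
  have [_ n10] := cP _ _ lt01; have [c12 n21] := cP _ _ lt12.
  exact: (no_chain2 dim1 c12 n10 n21).
have [s vs gens] : exists2 s, vanishes_at P s &
    forall v, vanishes_at P v -> exists2 r, regular_at P r & v = s * r.
  case: d t ht gen d2 {c cP} => [|[|//]] t ht gen _.
    exists 0; first exact: vanishes0.
    by move=> v /gen[a _]; rewrite big_ord0 => ->; exists 0; rewrite ?mulr0 //; exact: regular0.
  exists (t ord0) => // v /gen[a ha ->]; exists (a ord0) => //.
  by rewrite big_ord1 mulrC.
have factor a : regular_at P a -> a != 0 ->
    exists n w, [/\ regular_at P w, ~ vanishes_at P w & a = s ^+ n * w].
  move=> ha a0; have [va|na] := pselect (vanishes_at P a); last first.
    by exists 0, a; rewrite mul1r.
  have s0 : s != 0.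
    by apply: contra_neq a0 => s0; have [r _ ->] := gens _ va; rewrite s0 mul0r.
  have exN : exists n, ~~ `[< exists2 r, regular_at P r & a = s ^+ n * r >].
    apply: contraPP a0 => no; apply/negP/negPn/eqP.
    apply: (infinitely_divisible_eq0 dim1 s0 vs) => n.
    by apply: contra_notP no => no; exists n; apply/asboolPn.
  (* Since n+1 is the least exponent for which the power of s does not divide a, s^n divides a and
     the quotient is a unit. *)
  case: (ex_minnP exN) => -[|n] /asboolPn nN min; first by case: nN; exists a; rewrite ?mul1r.
  have /asboolP[r hr aE] : `[< exists2 r, regular_at P r & a = s ^+ n * r >].
    by apply: contraT => /min; rewrite ltnn.
  exists n, r; split=> // /gens[r' hr' rE]; case: nN; exists r' => //.
  by rewrite aE rE mulrA -exprSr.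
have [a [b [ha hb b0 ->]]] := regular_fraction P u.
have [->|a0] := eqVneq a 0; first by left; rewrite mul0r; exact: regular0.
have [m [w [hw nw ->]]] := factor a ha a0.
have [n [w' [hw' nw' ->]]] := factor b hb b0.
(* For s = 0 the maximal ideal is zero; the powers of s are 0 or 1, and so are their inverses by the
   convention 0^-1 = 0. *)
have [s0|s0] := eqVneq s 0.
  have reg k : regular_at P (s ^+ k)^-1.
    by rewrite s0 expr0n; case: eqP => _; rewrite ?invr1 ?invr0; [exact: regular1|exact: regular0].
  by left; rewrite invfM; apply: regularM; apply: regularM => //;
    [exact/regularX/regular_vanishes | exact: regular_invr].
have [wr wr'] := (regular_invr hw nw, regular_invr hw' nw').
have quo k l v v' : (l <= k)%N -> regular_at P v -> regular_at P v'^-1 ->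
    regular_at P (s ^+ k * v / (s ^+ l * v')).
  move=> lk hv hv'; rewrite -mulf_div -expfB_cond ?(negbTE s0) //.
  by apply: regularM; [exact/regularX/regular_vanishes | exact: regularM].
case: (leqP n m) => [nm|/ltnW mn]; first by left; exact: quo.
by right; rewrite invf_div; exact: quo.
Qed.

End TranscendenceDegree.

(** * Morphisms to a projective variety given by field embeddings *)

Section ClosedSets.
Import GRing.Theory.
Local Open Scope ring_scope.
Variables (K : fieldType) (X : variety K).
Implicit Types (P : point X) (Z : point X -> Prop).

(** The defining set of equations can always be taken to be the whole ideal of [Z], which removes
    the choice of equations from the proofs below. *)
Lemma closed_setP Z : closed_set X Z <->
  (forall P, (forall f, (forall Q, Z Q -> Q f) -> P f) -> Z P).
Proof.
split=> [[S hS] P hP|hZ].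
  by apply/hS => f Sf; apply: hP => Q /hS; apply.
exists (fun f => forall Q, Z Q -> Q f) => P; split; last exact: hZ.
by move=> ZP f; apply.
Qed.

Lemma closed_set_forall (I : Type) (Z : I -> point X -> Prop) :
  (forall i, closed_set X (Z i)) -> closed_set X (fun P => forall i, Z i P).
Proof.
move=> hZ; apply/closed_setP => P hP i; have /closed_setP := hZ i; apply=> f hf.
by apply: hP => Q /(_ i); exact: hf.
Qed.

(** If some f vanishing on [Z1] is not in P, then for each g vanishing on [Z2] the product fg
    vanishes on the union, so primality puts g in P. *)
Lemma closed_setU Z1 Z2 : closed_set X Z1 -> closed_set X Z2 ->
  closed_set X (fun P => Z1 P \/ Z2 P).
Proof.
move=> /closed_setP h1 /closed_setP h2; apply/closed_setP => P hP.
have [|n1] := pselect (Z1 P); [by left | right].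
apply: h2 => g hg; apply: contra_notP n1 => npg; apply: h1 => f hf.
case: (@point_prime _ _ _ (pointP P) f g) => //; apply: hP => Q [/hf Qf|/hg Qg].
- by rewrite mulrC; exact: (pointM (pointP Q)).
- exact: (pointM (pointP Q)).
Qed.

Lemma closed_set_exists (n : nat) (Z : 'I_n -> point X -> Prop) :
  (forall i, closed_set X (Z i)) -> closed_set X (fun P => exists i, Z i P).
Proof.
elim: n Z => [|n IH] Z hZ.
  by apply/closed_setP => P hP; case: (point1 (pointP P)); apply: hP => Q [[]].
have /closed_setP hU := closed_setU (hZ ord0) (IH _ (fun i => hZ (lift ord0 i))).
apply/closed_setP => P hP.
have [//|h|[i h]] := hU P; last 2 first.
- by exists ord0.
- by exists (lift ord0 i).
move=> f hf; apply: hP => Q [i]; case: (unliftP ord0 i) => [j ->|->] h; apply: hf.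
- by right; exists j.
- by left.
Qed.

(** This is the locus of common zeros of all denominators of [u]. *)
Lemma closed_set_irregular u : closed_set X (fun P => ~ regular_at P u).
Proof.
apply/closed_setP => P hP [d [f [g [hf hg Pg uE]]]]; apply: Pg; apply: hP => Q nQ.
by have [//|Qg] := pselect (Q g); case: nQ; exists d, f, g.
Qed.

End ClosedSets.

(** * The center of a transported valuation on a projective variety *)

Section Center.
Import GRing.Theory.
Local Open Scope ring_scope.
Variables (K : fieldType) (X Y : variety K).
Variable s : {rmorphism funfield Y -> funfield X}.
Hypothesis s_cst : forall c, s (cst Y c) = cst X c.
Hypothesis valuation : forall (P : point X) u, regular_at P u \/ regular_at P u^-1.
Local Notation poly := {mpoly K[(adim Y).+1]}.
Local Notation x := (@Defs.coord K Y).
Implicit Types (P Q : point X) (f g : poly) (i j : 'I_(adim Y).+1).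

(** The coordinate [x i] has least valuation at P, so the center lies in the chart where [x i] does
    not vanish. *)
Definition pivot P i := x i != 0 /\ forall j, regular_at P (s (x j / x i)).

Lemma pivot_exists P : exists i, pivot P i.
Proof.
have [i0 xi0] := coord_neq0 Y.
suff [i xi hi] : exists2 i, x i != 0 &
    forall j, j \in enum 'I_(adim Y).+1 -> regular_at P (s (x j / x i)).
  by exists i; split=> // j; apply: hi; rewrite mem_enum.
elim: (enum _) => [|j l [i xi hi]]; first by exists i0.
case: (valuation P (s (x j / x i))) => [hj|].
  by exists i => // k; rewrite inE => /orP[/eqP-> //|]; exact: hi.
rewrite -fmorphV invf_div => hj.
(* A zero coordinate also reaches this case, as 0^-1 = 0 is regular; it cannot become the pivot. *)
have [xj0|xj] := eqVneq (x j) 0.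
  exists i => // k; rewrite inE => /orP[/eqP->|]; last exact: hi.
  by rewrite xj0 mul0r rmorph0; exact: regular0.
exists j => // k; rewrite inE => /orP[/eqP->|/hi hk].
  by rewrite divff // rmorph1; exact: regular1.
have -> : x k / x j = x k / x i * (x i / x j) by rewrite mulrA divfK.
by rewrite rmorphM; exact: regularM.
Qed.

Definition dehomog i d f : funfield Y := geval (pihomog mdeg d f) / x i ^+ d.

Lemma dehomogD i d f g : dehomog i d (f + g) = dehomog i d f + dehomog i d g.
Proof. by rewrite /dehomog /geval raddfD rmorphD mulrDl. Qed.

(** [cone_eval] is multiplicative and its coefficients are the values of the homogeneous components,
    so this is the Cauchy product. *)
Lemma dehomogM i d f g : x i != 0 ->
  dehomog i d (f * g) = \sum_(j < d.+1) dehomog i j f * dehomog i (d - j) g.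
Proof.
move=> xi; rewrite /dehomog -coef_cone_eval /cone_eval rmorphM /= coefM mulr_suml.
apply: eq_bigr => j _; rewrite -!/(cone_eval _) !coef_cone_eval mulf_div -exprD.
by rewrite subnKC // -ltnS.
Qed.

Lemma dehomog_homog i d f : f \is d.-homog -> dehomog i d f = geval f / x i ^+ d.
Proof. by move=> hf; rewrite /dehomog pihomog_dE. Qed.

Lemma dehomog_pihomog i d e f :
  dehomog i d (pihomog mdeg e f) = if d == e then dehomog i d f else 0.
Proof.
rewrite /dehomog; have [->|ne] := eqVneq d e; first by rewrite pihomog_id.
rewrite (pihomog_ne0 _ (pihomogP _ _ _)) 1?eq_sym //.
by rewrite /geval raddf0 mul0r.
Qed.

Lemma regular_dehomog_pivot P i d f : pivot P i -> regular_at P (s (dehomog i d f)).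
Proof.
move=> [xi hi]; rewrite /dehomog; have := pihomogP mdeg d f.
move: (pihomog _ _ _) => h /dhomogP hh.
rewrite /geval /mmap mulr_suml rmorph_sum big_seq.
elim/big_ind: _ => [|u v|m /hh /= md]; [exact: regular0 | exact: regularD |].
rewrite -mulrA rmorphM s_cst; apply: regularM; first exact: regular_cst.
rewrite -md mdegE (big_morph _ (exprD (x i)) (expr0 (x i))) /mmap1 -prodf_div rmorph_prod.
elim/big_ind: _ => [|u v|j _]; [exact: regular1 | exact: regularM |].
by rewrite -expr_div_n rmorphXn; exact: regularX.
Qed.

(** Contraction of the maximal ideal at P along [s], tested on each homogeneous component because
    the ideal of a point must be homogeneous. *)
Definition center P i f := forall d, vanishes_at P (s (dehomog i d f)).

(* Primality is Gauss's lemma: the product of the lowest components of f and g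
   that are units is a unit component of f g modulo the maximal ideal. *)
Lemma center_point P i : pivot P i -> is_point (center P i).
Proof.
move=> pv; have [xi hi] := pv; have reg d f := regular_dehomog_pivot d f pv.
split.
- by move=> d; rewrite /dehomog /geval !raddf0 mul0r rmorph0; exact: vanishes0.
- by move=> f g cf cg d; rewrite dehomogD rmorphD; exact: vanishesD.
- move=> f g cg d; rewrite dehomogM // rmorph_sum.
  elim/big_ind: _ => [|u v|j _]; [exact: vanishes0 | exact: vanishesD |].
  by rewrite rmorphM; exact: vanishesM.
- move=> d f cf e; rewrite dehomog_pihomog; case: eqP => // _.
  by rewrite rmorph0; exact: vanishes0.
- move=> /(_ 0); rewrite dehomog_homog ?dhomog1 // expr0 divr1 /geval !rmorph1.
  exact: vanishes1.
- move=> f g cfg; apply: contrapT => /not_orP[].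
  have low h : ~ center P i h -> exists2 d, ~ vanishes_at P (s (dehomog i d h)) &
      forall e, (e < d)%N -> vanishes_at P (s (dehomog i e h)).
    move=> nh; have ex : exists d, ~~ `[< vanishes_at P (s (dehomog i d h)) >].
      by apply: contra_notP nh => no d; apply: contra_notP no => no; exists d; apply/asboolPn.
    case: (ex_minnP ex) => d /asboolPn nd min; exists d => // e.
    move=> ed; apply: contrapT => ne; move: ed; rewrite ltnNge min //.
    exact/asboolPn.
  move=> /low[d nd hd] /low[e ne he].
  have := cfg (d + e)%N; rewrite dehomogM // rmorph_sum.
  have dlt : (d < (d + e).+1)%N by rewrite ltnS leq_addr.
  rewrite (bigD1 (Ordinal dlt)) //= addKn rmorphM => vsum.
  suff /(vanishes_prime (reg _ _) (reg _ _))[] :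
      vanishes_at P (s (dehomog i d f) * s (dehomog i e g)) by [].
  move: vsum; set a := _ * _; set b := (X in _ + X) => vab.
  have vb : vanishes_at P b.
    rewrite /b; elim/big_ind: _ => [|u v|j jd]; [exact: vanishes0 | exact: vanishesD |].
    rewrite rmorphM; have [jlt|jgt|/eqP] := ltngtP j d.
    + by rewrite mulrC; apply: vanishesM; [exact: reg | exact: hd].
    + apply: vanishesM; [exact: reg | apply: he].
      by rewrite ltn_subLR ?ltn_add2r // -ltnS.
    + by move=> /eqP jE; case/eqP: jd; exact: val_inj.
  rewrite -(addrK b a) -mulN1r; apply: vanishesD => //; apply: vanishesM => //.
  by apply: regularN; exact: regular1.
- move=> f vf d; rewrite /dehomog vf mul0r rmorph0; exact: vanishes0.
- exists i => /(_ 1%N); rewrite dehomog_homog ?homog_X // /geval mmapX mmap1U expr1 divff //.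
  by rewrite rmorph1; exact: vanishes1.
Qed.

Definition pivot_at P := projT1 (cid (pivot_exists P)).

Lemma pivot_atP P : pivot P (pivot_at P).
Proof. exact: projT2 (cid (pivot_exists P)). Qed.

Definition center_map P : point Y := Point (center_point (pivot_atP P)).

Lemma center_homog P d f : f \is d.-homog ->
  center_map P f <-> vanishes_at P (s (geval f / x (pivot_at P) ^+ d)).
Proof.
move=> hf; split=> [/(_ d)|h e]; first by rewrite dehomog_homog.
have [->|ne] := eqVneq e d; first by rewrite dehomog_homog.
by rewrite /dehomog (pihomog_ne0 _ hf) 1?eq_sym // /geval raddf0 mul0r rmorph0; exact: vanishes0.
Qed.

(** Dividing f and g by the same power of the pivot coordinate makes the denominator a unit at P, so
    f/g differs from the dehomogenized f by a regular factor. *)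
Lemma center_fraction P d f g : f \is d.-homog -> g \is d.-homog -> ~ center_map P g ->
  regular_at P (s (geval f / x (pivot_at P) ^+ d)) /\
  exists2 r, regular_at P r & s (geval f / geval g) = r * s (geval f / x (pivot_at P) ^+ d).
Proof.
move=> hf hg ncg; have [xi _] := pivot_atP P.
have nv : ~ vanishes_at P (s (geval g / x (pivot_at P) ^+ d)).
  by move=> h; apply: ncg; apply/(center_homog _ hg).
split; first by rewrite -dehomog_homog //; exact: regular_dehomog_pivot (pivot_atP P).
exists (s (geval g / x (pivot_at P) ^+ d))^-1.
  by apply: regular_invr => //; rewrite -dehomog_homog //; exact: regular_dehomog_pivot (pivot_atP P).
rewrite -fmorphV -rmorphM invf_div; congr (s _).
by rewrite mulf_div [_ ^+ d * _]mulrC -mulf_div divff ?mulr1 // expf_neq0.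
Qed.

Lemma center_regular P u : regular_at (center_map P) u -> regular_at P (s u).
Proof.
move=> [d [f [g [hf hg ncg ->]]]].
by have [hr [r ? ->]] := center_fraction hf hg ncg; exact: regularM.
Qed.

Lemma center_local P u : vanishes_at (center_map P) u -> vanishes_at P (s u).
Proof.
move=> [d [f [g [hf hg /(center_homog P hf) cf ncg ->]]]].
by have [_ [r ? ->]] := center_fraction hf hg ncg; exact: vanishesM.
Qed.

Lemma center_generic u : regular_at (center_map (generic X)) u.
Proof.
have [d [f [g [hf hg g0 ->]]]] := funfield_ratio u.
exists d, f, g; split=> // /(center_homog _ hg)/vanishes_generic/eqP.
have [xi _] := pivot_atP (generic X).
rewrite fmorph_eq0 mulf_eq0 invr_eq0 expf_eq0 (negbTE xi) andbF orbF.
by rewrite /geval (negbTE g0).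
Qed.

(* The right-hand side does not mention the pivot, which depends on P. *)
Lemma center_homogE P d f : f \is d.-homog ->
  center_map P f <-> geval f = 0 \/ exists j, ~ regular_at P (s (x j ^+ d / geval f)).
Proof.
move=> hf; have [xi hi] := pivot_atP P; rewrite (center_homog P hf).
have hr : regular_at P (s (geval f / x (pivot_at P) ^+ d)).
  by rewrite -dehomog_homog //; exact: regular_dehomog_pivot (pivot_atP P).
have [f0|f0] := eqVneq (geval f) 0.
  by split=> _; [left | rewrite f0 mul0r rmorph0; exact: vanishes0].
split=> [v|[/eqP|[j nj]]]; [right | by rewrite (negbTE f0) |].
  exists (pivot_at P) => r; case: (vanishes_mulN1 v r).
  by rewrite -rmorphM mulf_div [geval f * _]mulrC divff ?rmorph1 // mulf_neq0 // expf_neq0.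
(* The ratio with the pivot has least valuation: if it were regular, multiplying it by the regular
   (x_j/x_i)^d would make every ratio regular. *)
apply/vanishesE; split=> //; right; rewrite -fmorphV invf_div => r; apply: nj.
have -> : x j ^+ d / geval f
    = (x j / x (pivot_at P)) ^+ d * (x (pivot_at P) ^+ d / geval f).
  by rewrite [RHS]mulrA -exprMn divfK.
rewrite rmorphM rmorphXn.
by apply: regularM => //; apply: regularX; exact: hi.
Qed.

(** By [center_homogE] the preimage is an intersection, over the components of the equations, of
    finite unions of irregular loci. *)
Lemma center_continuous Z : closed_set Y Z -> closed_set X (fun P => Z (center_map P)).
Proof.
move=> [S hS].
have -> : (fun P => Z (center_map P)) = (fun P => forall i : {f | S f}, forall d,
    geval (pihomog mdeg d (sval i)) = 0 \/
    exists j, ~ regular_at P (s (x j ^+ d / geval (pihomog mdeg d (sval i))))).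
  apply/funext => P; apply/propext; split=> [/hS hZ [f Sf] d|h].
    apply/(center_homogE P (pihomogP _ _ _)); apply: (point_homog (pointP _)).
    exact: hZ.
  apply/hS => f Sf; apply/point_homogP => d.
  by apply/(center_homogE P (pihomogP _ _ _)); exact: (h (exist _ f Sf)).
apply: closed_set_forall => i; apply: closed_set_forall => d; apply: closed_setU.
  (* This condition does not involve P: its locus is the whole of X or empty. *)
  have [e|ne] := pselect (geval (pihomog mdeg d (sval i)) = 0).
    exact/closed_setP.
  by apply/closed_setP => P hP; case: (point1 (pointP P)); exact: hP.
by apply: closed_set_exists => j; exact: closed_set_irregular.
Qed.

Lemma center_is_kmorphism : is_kmorphism center_map s.
Proof.
split.
- exact: center_continuous.
- exact: s_cst.
- by move=> u v _ _; rewrite rmorphB.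
- by move=> u v _ _; rewrite rmorphM.
- exact: center_regular.
- exact: center_local.
- by move=> u; case; exact: center_generic.
Qed.

Definition center_morphism : kmorphism X Y := KMorphism center_is_kmorphism.

End Center.

(** * Dominant morphisms and their function field embeddings *)

Section Dominant.
Import GRing.Theory.
Local Open Scope ring_scope.
Variable K : fieldType.
Implicit Types X Y Z : variety K.

(** Equivalent to sending the generic point to the generic point; in this form [pullback] is a ring
    homomorphism on the whole function field. *)
Definition dominant X Y (m : kmorphism X Y) :=
  forall u, regular_at (m (generic X)) u.

Lemma dominant_comp X Y Z (g : kmorphism Y Z) (f : kmorphism X Y) u :
  dominant (g \oM f) -> pullback (g \oM f) u = pullback f (pullback g u).
Proof. by move=> dgf; rewrite /= (comp_pullbackE (dgf u)). Qed.

Lemma point_ext X (P Q : point X) : (forall f, P f <-> Q f) -> P = Q.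
Proof.
case: P Q => [p hp] [q hq] /= pq.
have e : p = q by apply/funext => f; apply/propext.
by subst q; congr Point; exact: Prop_irrelevance.
Qed.

Lemma dominant_generic X Y (m : kmorphism X Y) : dominant m -> m (generic X) = generic Y.
Proof.
move=> dm; apply: point_ext => f; split; last exact: generic_min.
move=> mf d; have hf := pihomogP mdeg d f.
have [i mi] := point_relevant (pointP (m (generic X))).
have := point_homog (pointP (m (generic X))) d mf.
move=> /(vanishes_dehomog mi hf)/vanishesE[_ [/eqP|[]//]].
by rewrite mulf_eq0 invr_eq0 expf_eq0 (negbTE (coord_neq0_at mi)) andbF orbF => /eqP.
Qed.

Lemma dominantM X Y Z (g : kmorphism Y Z) (f : kmorphism X Y) :
  dominant g -> dominant f -> dominant (g \oM f).
Proof. by move=> dg /dominant_generic df u; rewrite /= df. Qed.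

(** [pullback] is 0 where it is undefined, whereas a field embedding kills only 0, which is regular
    everywhere. *)
Lemma dominant_embedding X Y (m : kmorphism X Y) e :
  function_field_embedding m e -> dominant m.
Proof.
move=> me u; apply: contrapT => nr; have := me u; rewrite (mor_undef (kmorphismP m)) //.
by move=> /esym/eqP; rewrite fmorph_eq0 => /eqP u0; apply: nr; rewrite u0; exact: regular0.
Qed.

(** [m'] takes the image of the generic point under [m] back to the generic point, where everything
    is regular, and regularity passes to generizations. *)
Lemma dominant_retraction X Y (m : kmorphism X Y) (m' : kmorphism Y X) :
  m' \oM m = id_mor X -> dominant m'.
Proof.
move=> m'm u; apply: (kmorphism_specialize (P := m (generic X))).
have -> : m' (m (generic X)) = generic X by rewrite -[LHS]/((m' \oM m) (generic X)) m'm.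
exact: regular_generic.
Qed.

Lemma dominant_pullback X Y (m : kmorphism X Y) : dominant m ->
  exists e : {rmorphism funfield Y -> funfield X}, function_field_embedding m e.
Proof.
move=> dm; have mP := kmorphismP m.
have zm : zmod_morphism (pullback m) by move=> u v; apply: (mor_sub mP).
have mm : monoid_morphism (pullback m).
  split; last by move=> u v; apply: (mor_mul mP).
  by rewrite -(rmorph1 (cst Y)) (mor_cst mP) rmorph1.
pose add := GRing.isZmodMorphism.Build _ _ (pullback m) zm.
pose mul := GRing.isMonoidMorphism.Build _ _ (pullback m) mm.
pose e : {rmorphism funfield Y -> funfield X} := HB.pack (pullback m) add mul.
by exists e.
Qed.

(* At every P both images are dominated, through the common pullback, by the
   local ring at P; the comparison is made in one affine chart containing both. *)
Lemma kmorphism_determined X Y (m m' : kmorphism X Y) (e : {rmorphism funfield Y -> funfield X}) :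
  function_field_embedding m e -> function_field_embedding m' e -> m = m'.
Proof.
move=> em em'.
have ss : pullback m = pullback m' by apply/funext => u; rewrite em em'.
apply: kmorphism_eq => //; apply/funext => P.
have [i mi] := point_relevant (pointP (m P)).
have [j mj] := point_relevant (pointP (m' P)).
have ri := regular_dehomog mi (homog_X j); have rj := regular_dehomog mj (homog_X i).
have gX k : geval ('X_k : {mpoly K[(adim Y).+1]}) = Defs.coord k.
  by rewrite -['X_k]expr1 geval_Xn.
rewrite !gX !expr1 in ri rj.
have xi := coord_neq0_at mi; have xj := coord_neq0_at mj.
(* Otherwise x_j/x_i would pull back into the maximal ideal at P through [m], while its inverse
   pulls back to a regular function through [m']. *)
have mj' : ~ m P 'X_j.
  move=> /(vanishes_dehomog mi (homog_X j)); rewrite gX expr1.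
  move=> /(mor_local (kmorphismP m)); rewrite em => v.
  have := mor_regular (kmorphismP m') rj; rewrite em' => r.
  by case: (vanishes_mulN1 v r); rewrite -rmorphM mulf_div [X in X / _]mulrC divff ?rmorph1 // mulf_neq0.
have vE (n : kmorphism X Y) d f : function_field_embedding n e -> ~ n P 'X_j -> f \is d.-homog ->
    n P f <-> vanishes_at P (e (geval f / Defs.coord j ^+ d)).
  move=> en nj hf; rewrite -(vanishes_dehomog nj hf) -en.
  split=> [|v]; first exact: (mor_local (kmorphismP n)).
  apply: contrapT => nv.
  have /(mor_regular (kmorphismP n)) := regular_invr (regular_dehomog nj hf) nv.
  rewrite !en fmorphV => r; rewrite en in v; apply: (vanishes_mulN1 v r).
  rewrite divff // fmorph_eq0; apply: contra_notN nv => /eqP->; exact: vanishes0.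
apply: point_ext => f; rewrite !point_homogP; split=> h d; have := h d.
  by move=> /(vE _ _ _ em mj' (pihomogP _ _ _)) ?; apply/(vE _ _ _ em' mj (pihomogP _ _ _)).
by move=> /(vE _ _ _ em' mj (pihomogP _ _ _)) ?; apply/(vE _ _ _ em mj' (pihomogP _ _ _)).
Qed.

Lemma dominant_eq X Y (m m' : kmorphism X Y) :
  dominant m -> pullback m = pullback m' -> m = m'.
Proof.
by move=> /dominant_pullback[e em] ss; apply: (kmorphism_determined em) => u; rewrite -ss em.
Qed.

End Dominant.

(** * Descent of automorphisms *)

Section Descent.
Import GRing.Theory.
Local Open Scope ring_scope.
Variable K : fieldType.

(** The pullback of [f] is a field homomorphism, hence injective, so the pullbacks of [g] and [g']
    agree. *)
Lemma dominant_epi (X Y Z : variety K) (f : kmorphism X Y) (g g' : kmorphism Y Z) :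
  dominant f -> dominant g -> dominant g' -> g \oM f = g' \oM f -> g = g'.
Proof.
move=> df dg dg' gf; apply: dominant_eq => //; apply/funext => u.
have [e fe] := dominant_pullback df.
apply: (fmorph_inj e); rewrite -!fe -!dominant_comp ?gf //; exact: dominantM.
Qed.

Lemma cover_aut_dominant (X Y : variety K) (phi : kmorphism X Y) (mu : cover_aut phi) :
  dominant mu.
Proof. exact: dominant_retraction (aut_invr mu). Qed.

Lemma restrict_endomorphism (A B : fieldType) (j : {rmorphism A -> B}) (sigma : {rmorphism B -> B}) :
  (forall x, exists y, sigma (j x) = j y) ->
  exists tau : {rmorphism A -> A}, forall x, j (tau x) = sigma (j x).
Proof.
move=> /choice[t ht].
have zm : zmod_morphism t.
  by move=> u v; apply: (fmorph_inj j); rewrite rmorphB -!ht !rmorphB.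
have mm : monoid_morphism t.
  split; first by apply: (fmorph_inj j); rewrite -ht !rmorph1.
  by move=> u v; apply: (fmorph_inj j); rewrite rmorphM -!ht !rmorphM.
pose add := GRing.isZmodMorphism.Build _ _ t zm.
pose mul := GRing.isMonoidMorphism.Build _ _ t mm.
pose tau : {rmorphism A -> A} := HB.pack t add mul.
by exists tau => x; rewrite ht.
Qed.

Variables (C C1 D : curve K) (theta : kmorphism C1 D) (rho : kmorphism C C1).
Variables (e1 : {rmorphism funfield D -> funfield C1}) (j : {rmorphism funfield C1 -> funfield C}).
Hypotheses (theta_e1 : function_field_embedding theta e1) (rho_j : function_field_embedding rho j).
Local Notation psi := (theta \oM rho).

Let dtheta : dominant theta := dominant_embedding theta_e1.
Let drho : dominant rho := dominant_embedding rho_j.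

(** The center construction on [C1] is applied to the restriction of [sigma] to K(C_1). Both
    composites are dominant with the same pullback, hence equal. *)
Lemma descend_morphism (m : kmorphism C C) (sigma : {rmorphism funfield C -> funfield C}) :
  function_field_embedding m sigma -> (forall x, exists y, sigma (j x) = j y) ->
  exists2 n : kmorphism C1 C1, dominant n & rho \oM m = n \oM rho.
Proof.
move=> ms /restrict_endomorphism[tau htau]; have dm := dominant_embedding ms.
have tau_cst c : tau (cst C1 c) = cst C1 c.
  apply: (fmorph_inj j); rewrite htau -rho_j (mor_cst (kmorphismP rho)) -ms.
  exact: (mor_cst (kmorphismP m)).
have val P u := local_ring_valuation P u (curve_dim C1) (curve_nonsingular (c := C1)).
pose n := center_morphism tau_cst val.
have dn : dominant n by apply: (@dominant_embedding _ _ _ n tau) => u.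
exists n => //; apply: dominant_eq; first exact: dominantM.
apply/funext => u; rewrite !dominant_comp; try exact: dominantM.
by rewrite ms !rho_j -htau.
Qed.

Hypothesis invariant : forall sigma : {rmorphism funfield C -> funfield C},
  (forall a, sigma (j (e1 a)) = j (e1 a)) -> forall x, exists y, sigma (j x) = j y.

Lemma descend_cover_aut (mu : cover_aut psi) :
  exists2 n : kmorphism C1 C1, dominant n & rho \oM mu = n \oM rho.
Proof.
have dmu := cover_aut_dominant mu; have [sigma hs] := dominant_pullback dmu.
apply: (descend_morphism hs); apply: invariant => a.
have dpsi : dominant psi by exact: dominantM.
have psiE : j (e1 a) = pullback psi a by rewrite dominant_comp // theta_e1 rho_j.
by rewrite psiE -hs -dominant_comp ?aut_over.
Qed.

(** Cancelling [rho] on the right shows that the descents of [mu] and of its inverse are mutually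
    inverse, that they lie over [theta], and that they are unique. *)
Lemma descend_cover_aut_unique (mu : cover_aut psi) :
  exists! nu : cover_aut theta, rho \oM mu = nu \oM rho.
Proof.
have [n dn hn] := descend_cover_aut mu.
have [n' dn' hn'] := descend_cover_aut (aut_inverse mu).
have inv1 : n \oM n' = id_mor C1.
  apply: (dominant_epi drho); [exact: dominantM | exact: regular_generic |].
  by rewrite comp_1mor -comp_morA -hn' comp_morA -hn -comp_morA aut_invr comp_mor1.
have inv2 : n' \oM n = id_mor C1.
  apply: (dominant_epi drho); [exact: dominantM | exact: regular_generic |].
  by rewrite comp_1mor -comp_morA -hn comp_morA -hn' -comp_morA aut_invl comp_mor1.
have over : theta \oM n = theta.
  apply: (dominant_epi drho) => //; first exact: dominantM.
  by rewrite -comp_morA -hn comp_morA aut_over.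
exists (CoverAut inv1 inv2 over); split=> // nu hnu.
by apply: aut_eq; apply: (dominant_epi drho) => //=; [exact: cover_aut_dominant | rewrite -hn].
Qed.

(** Multiplicativity follows from uniqueness. The kernel is compared with Aut(rho) through
    underlying morphisms, since automorphisms of [psi] and of [rho] form different types. *)
Lemma descent_homomorphism : exists Phi : {multiplicative cover_aut psi -> cover_aut theta},
  (forall mu : cover_aut psi, rho \oM mu = Phi mu \oM rho) /\
  (forall m : kmorphism C C,
     (exists2 mu : cover_aut psi, aut_mor mu = m & Phi mu = 1%g) <->
     (exists kappa : cover_aut rho, aut_mor kappa = m)).
Proof.
have ex (mu : cover_aut psi) : exists nu : cover_aut theta, rho \oM mu = nu \oM rho.
  by have [nu [h _]] := descend_cover_aut_unique mu; exists nu.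
have [phi hphi] := choice ex.
have uniq (a b : cover_aut theta) : a \oM rho = b \oM rho -> a = b.
  by move=> ab; apply: aut_eq; apply: (dominant_epi drho ) => //; exact: cover_aut_dominant.
have phiM : {morph phi : a b / (a * b)%g >-> (a * b)%g}.
  move=> a b; apply: uniq.
  by rewrite -hphi [in RHS]/= -comp_morA -hphi comp_morA -hphi -comp_morA.
pose mix := isMultiplicative.Build _ _ phi phiM.
pose Phi : {multiplicative cover_aut psi -> cover_aut theta} := HB.pack phi mix.
exists Phi; split=> // m; split=> [[mu <- phi1]|[kappa <-]].
  have over : rho \oM mu = rho by rewrite hphi [phi mu]phi1 comp_1mor.
  by exists (CoverAut (aut_invr mu) (aut_invl mu) over).
have over : psi \oM kappa = psi by rewrite -comp_morA aut_over.
exists (CoverAut (aut_invr kappa) (aut_invl kappa) over) => //.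
by apply: uniq; rewrite -hphi /= aut_over comp_1mor.
Qed.

End Descent.

Theorem theorem1p2 (K : fieldType) (C C1 D : curve K)
  (theta : kmorphism C1 D) (rho : kmorphism C C1)
  (theta_cover : is_cover theta) (rho_cover : is_cover rho)
  (e : {rmorphism funfield D -> funfield C})
  (e_psi : function_field_embedding (theta \oM rho) e)
  (Omega : alg_closure (funfield D)) (N : galois_closure e Omega)
  (H : {group gal_of (fullv : {vspace N})})
  (H_mon : H \subset mon N)
  (H_transitive : mon_transitive H)
  (H_dedekind : dedekind H) :
  let psi := theta \oM rho in
  (forall mu : cover_aut psi, exists! nu : cover_aut theta, rho \oM mu = nu \oM rho) /\
  (exists Phi : {multiplicative cover_aut psi -> cover_aut theta},
     (forall mu : cover_aut psi, rho \oM mu = Phi mu \oM rho) /\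
     (forall m : kmorphism C C,
        (exists2 mu : cover_aut psi, aut_mor mu = m & Phi mu = 1%g) <->
        (exists kappa : cover_aut rho, aut_mor kappa = m))).
Proof.
have [_ [e1 theta_e1 _]] := theta_cover.
have [_ [j rho_j _]] := rho_cover.
have jE a : j (e1 a) = e a.
  rewrite -e_psi -theta_e1 -rho_j dominant_comp //.
  exact: dominantM (dominant_embedding theta_e1) (dominant_embedding rho_j).
have invariant (sigma : {rmorphism funfield C -> funfield C}) :
    (forall a, sigma (j (e1 a)) = j (e1 a)) -> forall x, exists y, sigma (j x) = j y.
  move=> sE; apply: (automorphism_preserves_image H_transitive H_dedekind jE) => a.
  by rewrite -jE sE.
split; first exact: descend_cover_aut_unique theta_e1 rho_j invariant.
exact: descent_homomorphism theta_e1 rho_j invariant.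
Qed.
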